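(* Let $R$ be a ring. The following statements are equivalent. 1. $Q_{l,\mathrm{cl}}(R)$ is a semisimple Artinian ring. 2. $R$ is a semiprime ring, $\mathrm{udim}({}_RR)<\infty$, ${}'\mathcal{C}_R=\mathcal{C}_R$, and ${}'\mathcal{C}_U\neq\emptyset$ for all uniform left ideals $U$ of $R$.
   Context: Rings are associative with $1$. ${}'\mathcal{C}_R$ is the set of left regular elements of $R$: those $r\in R$ such that $xr=0$ ($x\in R$) implies $x=0$. $\mathcal{C}_R$ is the set of regular elements: those $r$ such that $xr=0$ implies $x=0$ and $rx=0$ implies $x=0$. For a left ideal $I$ of $R$, ${}'\mathcal{C}_I:=\{i\in I\mid I\to I,\ x\mapsto xi,\text{ is injective}\}$. $Q_{l,\mathrm{cl}}(R):=\mathcal{C}_R^{-1}R$ is the classical left quotient ring; it exists exactly when $\mathcal{C}_R$ is a left Ore set (i.e. $\mathcal{C}_Rr\cap Rc\neq\emptyset$ for all $r\in R$, $c\in\mathcal{C}_R$), and the assertion that it is semisimple Artinian includes the assertion that it exists. A nonzero module is uniform if any two of its nonzero submodules have nonzero intersection; a uniform left ideal is a left ideal that is uniform as a left module. $\mathrm{udim}({}_RR)<\infty$ means that there are finitely many uniform left ideals of $R$ whose sum is direct and is an essential left ideal of $R$. *)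

(* Defs.v *)
From HB Require Import structures.
From mathcomp Require Import all_boot all_algebra.
From mathcomp Require Import boolp classical_sets functions.

Set Implicit Arguments.
Unset Strict Implicit.
Unset Printing Implicit Defensive.

Import GRing.Theory.
Local Open Scope classical_set_scope.
Local Open Scope ring_scope.

(* Rings are [pzRingType]s: associative with 1, possibly trivial. The left     *)
(* regular module of [R] is [R^o], so a left ideal of [R] is a submodule of    *)
(* [R^o].                                                                      *)

Section Modules.
Context {R : pzRingType} {M : lmodType R}.
Implicit Types L N : set M.

Definition submodule N := submod_closed [in N].

Definition sum_submodules n (N : 'I_n -> set M) : set M :=
  [set \sum_i v i | v in [set v : 'I_n -> M | forall i, N i (v i)]].

Definition direct_sum_submodules n (N : 'I_n -> set M) :=
  forall v : 'I_n -> M, (forall i, N i (v i)) ->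
    \sum_i v i = 0 -> forall i, v i = 0.

Definition simple_submodule N :=
  [/\ submodule N, N <> [set 0] &
      forall L, submodule L -> L `<=` N -> L = [set 0] \/ L = N].

Definition uniform_submodule N :=
  [/\ submodule N, N <> [set 0] &
      forall L1 L2, submodule L1 -> submodule L2 ->
        L1 `<=` N -> L2 `<=` N -> L1 <> [set 0] -> L2 <> [set 0] ->
        L1 `&` L2 <> [set 0]].

Definition essential_submodule N :=
  submodule N /\ forall L, submodule L -> L <> [set 0] -> N `&` L <> [set 0].

End Modules.

Definition finite_udim (R : pzRingType) (M : lmodType R) :=
  exists n (U : 'I_n -> set M),
    [/\ forall i, uniform_submodule (U i), direct_sum_submodules U &
        essential_submodule (sum_submodules U)].

(* [M] is the sum of its simple submodules. *)
Definition semisimple_module (R : pzRingType) (M : lmodType R) :=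
  forall x : M, exists n (N : 'I_n -> set M),
    (forall i, simple_submodule (N i)) /\ sum_submodules N x.

Definition artinian_module (R : pzRingType) (M : lmodType R) :=
  forall N : nat -> set M, (forall k, submodule (N k)) ->
    (forall k, N k.+1 `<=` N k) ->
    exists m, forall k, (m <= k)%N -> N k = N m.

Section Rings.
Context {R : pzRingType}.

Definition semisimple_artinian_ring :=
  semisimple_module R^o /\ artinian_module R^o.

Definition two_sided_ideal (I : set R^o) :=
  submodule I /\ forall x r : R, I x -> I (x * r).

Definition nilpotent_ideal (I : set R^o) :=
  exists n, forall v : 'I_n -> R, (forall i, I (v i)) -> \prod_i v i = 0.

Definition semiprime_ring :=
  forall I : set R^o, two_sided_ideal I -> nilpotent_ideal I -> I = [set 0].

(* ['C_R] *)
Definition left_regular : set R := [set r | forall x, x * r = 0 -> x = 0].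

(* [C_R] *)
Definition regular : set R :=
  [set r | (forall x, x * r = 0 -> x = 0) /\ (forall x, r * x = 0 -> x = 0)].

(* ['C_I]; right multiplication by an element of a left ideal [I] maps [I] to  *)
(* itself.                                                                     *)
Definition left_regular_in (I : set R^o) : set R :=
  [set i | I i /\ set_inj I (fun x : R => x * i)].

Definition left_Ore (S : set R) :=
  forall r c, S c -> exists s t, S s /\ s * r = t * c.

End Rings.

Arguments semisimple_artinian_ring : clear implicits.
Arguments semiprime_ring : clear implicits.
Arguments left_regular : clear implicits.
Arguments regular : clear implicits.

(* [f : R -> Q] presents [Q] as [S^-1 R]. This determines [(Q, f)] up to       *)
(* unique isomorphism. [f s * q = f r] says [q = (f s)^-1 * f r].              *)
Definition left_quotient_ring (R : pzRingType) (S : set R) (Q : pzRingType)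
    (f : {rmorphism R -> Q}) :=
  [/\ forall s, S s -> exists u, u * f s = 1 /\ f s * u = 1,
      forall q, exists s r, S s /\ f s * q = f r &
      forall r, f r = 0 <-> exists s, S s /\ s * r = 0].

Definition Qlcl_semisimple_artinian (R : pzRingType) :=
  left_Ore (regular R) /\
  exists (Q : pzRingType) (f : {rmorphism R -> Q}),
    left_quotient_ring (regular R) f /\ semisimple_artinian_ring Q.

(* Main.v *)
From HB Require Import structures.
Require Import Defs.
From mathcomp Require Import all_boot all_algebra.
From mathcomp Require Import boolp classical_sets functions.

Set Implicit Arguments.
Unset Strict Implicit.
Unset Printing Implicit Defensive.

Import GRing.Theory.
Local Open Scope quotient_scope.
Local Open Scope classical_set_scope.
Local Open Scope ring_scope.

(** Both implications pass through the statement that every essential left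
    ideal of [R] contains a regular element ([essential_meets_regular]). It
    turns nonzero multiples into regular ones: if every nonzero multiple of
    [x] has a nonzero multiple in a left ideal [N], then [s * x] lies in [N]
    for some regular [s] ([regular_multiple_in]).

    From 2 to 1. Let [U_0 + ... + U_(n-1)] be direct and essential with
    uniform summands, and let [S i] be the sum of the first [i] of them. Given
    an essential left ideal [E], an element [c] of [E] whose left annihilator
    misses [S i] is built by induction on [i]: if the annihilator of [c] meets
    [S i.+1], its intersection with [E] and [S i.+1] is a uniform left ideal
    [V], and an element of ['C_V] is added to [c]
    ([left_regular_in_essential]). At the end [c] is left regular, hence
    regular.

    The same flag [S] shows that a descending chain [A k] of left ideals of [R]
    is stationary up to torsion: from some [m] on, every element of [A m] has
    a regular multiple in [A k] ([descending_chain_torsion]). For the chain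
    [R c^k] this is the left Ore condition at [c]; for the chain of
    contractions of left ideals of [Q] it says that [Q] is left Artinian. The
    quotient ring [Q] is built as a ring of germs of partial right
    multiplications ([fractions_left_quotient_ring]).
    The left ideals [Q U_i] are simple and their sum contains a unit, so [Q]
    is semisimple.

    From 1 to 2. If [E] is essential in [R], then [Q E] meets, hence contains,
    every simple left ideal of [Q], so [Q E = Q] and [E] contains a regular
    element. The right annihilator of a nilpotent ideal is essential as a left
    ideal, so such an ideal vanishes and [R] is semiprime. If ['C_U] were
    empty, every [u] in [U] would kill a nonzero element of [U], hence a
    regular multiple of each element of [U], and [U] would have square zero.
    A left regular [r] is regular because the chain [Q r^k] stops. Finally,
    a decomposition of [Q] into simple left ideals contracts to an essential
    direct sum of uniform left ideals of [R]. *)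

(** * Ore localization *)

(** As the denominators are left regular, left reversibility ([r * s = 0]
    implies [t * r = 0] for some denominator [t]) is automatic, and these
    conditions suffice to form the ring of left fractions. *)
Definition left_denominator_set (R : pzRingType) (S : set R) :=
  [/\ S 1, forall s t, S s -> S t -> S (s * t), left_Ore S &
      S `<=` left_regular R].

(** Right multiplication by [s^-1 r] sends [x * s] to [x * r], so it is a map
    from [R] to [R] on the left ideal [R s]. Extending it arbitrarily to [R]
    and identifying maps that agree on some [R t] with [t] a denominator gives
    a model of the fractions in which addition is pointwise, multiplication is
    composition, and associativity holds on the nose; no equivalence of pairs
    [(s, r)] has to be handled. *)
Section OreLocalization.
Context {R : pzRingType} {S : set R}.
Hypothesis denS : left_denominator_set S.

Let S1 : S 1. Proof. by case: denS. Qed.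
Let SM s t : S s -> S t -> S (s * t). Proof. by case: denS => _ + _ _; apply. Qed.
Let SO : left_Ore S. Proof. by case: denS. Qed.
Let Sreg s x : S s -> x * s = 0 -> x = 0.
Proof. by case: denS => _ _ _ + /[dup] => /[apply] + _; apply. Qed.

Lemma left_Ore_common s t : S s -> S t ->
  exists a b, [/\ S (a * s), S a & a * s = b * t].
Proof.
by move=> Ss St; have [a [b [Sa e]]] := SO s St; exists a, b; split; auto.
Qed.

Definition is_fraction_map : {pred R -> R} :=
  [pred phi | `[< exists s r, S s /\ forall x, phi (x * s) = x * r >]].

Lemma is_fraction_mapP (phi : R -> R) :
  reflect (exists s r, S s /\ forall x, phi (x * s) = x * r)
          (phi \in is_fraction_map).
Proof. exact: asboolP. Qed.

Lemma is_fraction_map_zmod_closed : zmod_closed is_fraction_map.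
Proof.
split=> [|phi psi /is_fraction_mapP[s [r [Ss phiE]]]
             /is_fraction_mapP[t [u [St psiE]]]]; apply/is_fraction_mapP.
  by exists 1, 0; split=> // x; rewrite mulr0.
have [a [b [Sas _ e]]] := left_Ore_common Ss St.
exists (a * s), (a * r - b * u); split=> // x.
by rewrite !fctE {2}e !mulrA phiE psiE mulrBr !mulrA.
Qed.

HB.instance Definition _ :=
  GRing.isZmodClosed.Build (R -> R) is_fraction_map is_fraction_map_zmod_closed.

Definition fraction_map : Type := {phi | phi \in is_fraction_map}.
HB.instance Definition _ := SubChoice.on fraction_map.
HB.instance Definition _ := [SubChoice_isSubZmodule of fraction_map by <:].

Definition FractionMap phi (Phi : phi \in is_fraction_map) : fraction_map :=
  exist (fun phi => is_true (phi \in is_fraction_map)) phi Phi.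

Lemma fraction_mapD (phi psi : fraction_map) x :
  val (phi + psi) x = val phi x + val psi x.
Proof. by rewrite raddfD. Qed.

Lemma fraction_mapB (phi psi : fraction_map) x :
  val (phi - psi) x = val phi x - val psi x.
Proof. by rewrite raddfB. Qed.

Lemma fraction_mapP (phi : fraction_map) :
  exists s r, S s /\ forall x, val phi (x * s) = x * r.
Proof. exact/is_fraction_mapP/(valP phi). Qed.

Definition null_germ : {pred fraction_map} :=
  [pred phi | `[< exists s, S s /\ forall x, val phi (x * s) = 0 >]].

Lemma null_germP (phi : fraction_map) :
  reflect (exists s, S s /\ forall x, val phi (x * s) = 0)
          (phi \in null_germ).
Proof. exact: asboolP. Qed.

Lemma null_germ_zmod_closed : zmod_closed null_germ.
Proof.
split=> [|phi psi /null_germP[s [Ss phi0]]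
             /null_germP[t [St psi0]]]; apply/null_germP.
  by exists 1; split.
have [a [b [Sas _ e]]] := left_Ore_common Ss St.
exists (a * s); split=> // x.
by rewrite fraction_mapB {2}e !mulrA phi0 psi0 subr0.
Qed.

HB.instance Definition _ :=
  GRing.isZmodClosed.Build fraction_map null_germ null_germ_zmod_closed.

Definition fractions : Type := Quotient.quot null_germ.
HB.instance Definition _ := GRing.Zmodule.on fractions.
HB.instance Definition _ := EqQuotient.on fractions.
Definition germ (phi : fraction_map) : fractions := \pi_fractions phi.

Lemma germ_eq (phi psi : fraction_map) :
  germ phi = germ psi <->
  exists s, S s /\ forall x, val phi (x * s) = val psi (x * s).
Proof.
have -> : (germ phi = germ psi) <-> (phi - psi \in null_germ).
  by rewrite Quotient.idealrBE; apply: rwP eqP.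
split=> [/null_germP|] => [[s [Ss e]]|[s [Ss e]]].
  by exists s; split=> // x; apply/eqP; rewrite -subr_eq0 -(e x) fraction_mapB.
by apply/null_germP; exists s; split=> // x; rewrite fraction_mapB e subrr.
Qed.

Lemma germ_surj q : exists phi, germ phi = q.
Proof. by exists (repr q); exact: reprK. Qed.

Lemma germD (phi psi : fraction_map) : germ phi + germ psi = germ (phi + psi).
Proof. by rewrite /germ -[RHS]/(\pi_(Quotient.quot null_germ) _) !piE. Qed.

Lemma is_fraction_map_comp (phi psi : fraction_map) :
  val psi \o val phi \in is_fraction_map.
Proof.
have [s [r [Ss phiE]]] := fraction_mapP phi.
have [t [u [St psiE]]] := fraction_mapP psi.
have [a [b [Sa e]]] := SO r St.
apply/is_fraction_mapP; exists (a * s), (b * u); split; first exact: SM.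
by move=> x; rewrite /= mulrA phiE -mulrA e !mulrA psiE.
Qed.

(** Fractions act on the right, hence the product [phi psi] applies [phi]
    first. *)
Definition fraction_map_mul (phi psi : fraction_map) : fraction_map :=
  FractionMap (is_fraction_map_comp phi psi).

Lemma is_fraction_map_mulr (r : R) : (fun x => x * r) \in is_fraction_map.
Proof. by apply/is_fraction_mapP; exists 1, r; split=> // x; rewrite mulr1. Qed.

Definition right_mul_map r : fraction_map :=
  FractionMap (is_fraction_map_mulr r).

Definition fractions_mul (p q : fractions) :=
  germ (fraction_map_mul (repr p) (repr q)).

(** The composite of [phi] and [psi] only depends on their germs: agreement of
    [psi] and its representative on [R t] can be pulled back along [phi] by
    the Ore condition. *)
Lemma germM phi psi :
  fractions_mul (germ phi) (germ psi) = germ (fraction_map_mul phi psi).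
Proof.
have /germ_eq[s [Ss es]] := reprK (germ phi).
have /germ_eq[t [St et]] := reprK (germ psi).
apply/germ_eq; set phi' := repr _ in es *; set psi' := repr _ in et *.
have [s' [r [Ss' phiE]]] := fraction_mapP phi.
have [a [b [Sas Sa e]]] := left_Ore_common Ss' Ss.
have [a' [b' [Sa' e']]] := SO (a * r) St.
exists (a' * (a * s')); split; first exact: SM.
move=> x /=.
have phix : val phi (x * (a' * (a * s'))) = x * b' * t.
  by rewrite !mulrA phiE -!mulrA e'.
have phi'x : val phi' (x * (a' * (a * s'))) = x * b' * t.
  by rewrite -phix e !mulrA es.
by rewrite -[LHS]/(val psi' (val phi' _)) phi'x et -phix.
Qed.

Lemma fractions_mulA : associative fractions_mul.
Proof.
move=> x y z.
have [[phi <-] [psi <-]] := (germ_surj x, germ_surj y).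
have [chi <-] := germ_surj z.
by rewrite !germM; congr germ; apply: val_inj.
Qed.

Lemma fractions_mul1r : left_id (germ (right_mul_map 1)) fractions_mul.
Proof.
move=> x; have [phi <-] := germ_surj x; rewrite germM; congr germ.
by apply/val_inj/funext => y /=; rewrite mulr1.
Qed.

Lemma fractions_mulr1 : right_id (germ (right_mul_map 1)) fractions_mul.
Proof.
move=> x; have [phi <-] := germ_surj x; rewrite germM; congr germ.
by apply/val_inj/funext => y /=; rewrite mulr1.
Qed.

(** Fraction maps need not be additive, so this distributivity only holds on a
    left ideal [R s] that [phi] and [psi] both map into the left ideal where
    [chi] is a right multiplication. *)
Lemma fractions_mulDl : left_distributive fractions_mul +%R.
Proof.
move=> x y z.
have [[phi <-] [psi <-]] := (germ_surj x, germ_surj y).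
have [chi <-] := germ_surj z.
rewrite germD !germM germD; apply/germ_eq.
have [s [r [Ss phiE]]] := fraction_mapP phi.
have [t [u [St psiE]]] := fraction_mapP psi.
have [v [w [Sv chiE]]] := fraction_mapP chi.
have [a [b [Sas _ e]]] := left_Ore_common Ss St.
have [c [d [Sc ec]]] := SO (a * r) Sv.
have [c' [d' [Sc' ec']]] := SO (c * b * u) Sv.
exists (c' * c * (a * s)); split; first by apply: SM => //; apply: SM.
move=> g; rewrite fraction_mapD /=.
rewrite -[LHS]/(val chi (val (phi + psi) _)) fraction_mapD.
have phig : val phi (g * (c' * c * (a * s))) = g * c' * d * v.
  by rewrite !mulrA phiE -!mulrA ec.
have psig : val psi (g * (c' * c * (a * s))) = g * d' * v.
  by rewrite e !mulrA psiE -!mulrA -ec' !mulrA.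
rewrite -[RHS]/(val chi (val phi _) + val chi (val psi _)) phig psig.
by rewrite -mulrDl !chiE mulrDl.
Qed.

Lemma fractions_mulDr : right_distributive fractions_mul +%R.
Proof.
move=> x y z.
have [[phi <-] [psi <-]] := (germ_surj x, germ_surj y).
have [chi <-] := germ_surj z.
by rewrite germD !germM germD; congr germ; apply: val_inj.
Qed.

HB.instance Definition _ := GRing.Zmodule_isPzRing.Build fractions
  fractions_mulA fractions_mul1r fractions_mulr1 fractions_mulDl fractions_mulDr.

Definition to_fractions (r : R) : fractions := germ (right_mul_map r).

Lemma to_fractions_additive : zmod_morphism to_fractions.
Proof.
move=> x y; apply: (addIr (to_fractions y)); rewrite subrK germD; congr germ.
by apply/val_inj/funext => z; rewrite fraction_mapD /= -mulrDr subrK.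
Qed.

Lemma to_fractions_multiplicative : monoid_morphism to_fractions.
Proof.
split=> // x y; rewrite -[RHS]/(fractions_mul _ _) germM; congr germ.
by apply/val_inj/funext => z /=; rewrite mulrA.
Qed.

HB.instance Definition _ :=
  GRing.isZmodMorphism.Build R fractions to_fractions to_fractions_additive.
HB.instance Definition _ :=
  GRing.isMonoidMorphism.Build R fractions to_fractions to_fractions_multiplicative.

Lemma to_fractions_unit s : S s ->
  exists u, u * to_fractions s = 1 /\ to_fractions s * u = 1.
Proof.
move=> Ss; pose phi x := xget 0 [set y | y * s = x].
have phiE x : phi (x * s) = x.
  rewrite /phi; case: xgetP => [y _ /= e|/(_ x)/(_ erefl)//].
  by apply/eqP; rewrite -subr_eq0; apply/eqP/(Sreg Ss); rewrite mulrBl e subrr.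
have Phi : phi \in is_fraction_map.
  by apply/is_fraction_mapP; exists s, 1; split=> // x; rewrite phiE mulr1.
exists (germ (FractionMap Phi)); split; rewrite -[LHS]/(fractions_mul _ _) germM.
  by apply/germ_eq; exists s; split=> // x; rewrite /= phiE mulr1.
by apply/germ_eq; exists s; split=> // x; rewrite /= phiE mulr1.
Qed.

Theorem fractions_left_quotient_ring :
  exists (Q : pzRingType) (f : {rmorphism R -> Q}), left_quotient_ring S f.
Proof.
exists fractions, to_fractions; split; first exact: to_fractions_unit.
  move=> q; have [phi <-] := germ_surj q; have [s [r [Ss phiE]]] := fraction_mapP phi.
  exists s, r; split=> //; rewrite -[LHS]/(fractions_mul _ _) germM.
  by congr germ; apply/val_inj/funext => x; exact: phiE.
move=> r; have -> : 0 = to_fractions 0 by rewrite raddf0.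
split=> [/germ_eq[s [Ss e]]|[s [Ss e]]].
  by exists s; split=> //; have := e 1; rewrite /= mulr0 mul1r.
by apply/germ_eq; exists s; split=> // x; rewrite /= mulr0 -mulrA e mulr0.
Qed.

End OreLocalization.

(** * Left ideals and their elements *)

Section LeftIdeals.
Context {R : pzRingType}.
Implicit Types (I E L N U : set R^o) (a r s t x y : R).

Lemma left_ideal_intro I : I 0 -> (forall x y, I x -> I y -> I (x + y)) ->
  (forall a x, I x -> I (a * x)) -> submodule I.
Proof.
move=> I0 ID IM; split; first exact: mem_set.
by move=> a x y /set_mem Ix /set_mem Iy; apply/mem_set/ID => //; exact: IM.
Qed.

Lemma left_ideal0 I : submodule I -> I 0.
Proof. by case=> /set_mem. Qed.

Lemma left_idealMD I a x y : submodule I -> I x -> I y -> I (a * x + y).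
Proof. by case=> _ IMD Ix Iy; apply/set_mem/IMD; apply: mem_set. Qed.

Lemma left_idealD I x y : submodule I -> I x -> I y -> I (x + y).
Proof. by move=> sI Ix Iy; rewrite -[x]mul1r; exact: left_idealMD. Qed.

Lemma left_idealM I a x : submodule I -> I x -> I (a * x).
Proof.
by move=> sI Ix; rewrite -[_ * _]addr0; apply: left_idealMD => //;
  exact: left_ideal0.
Qed.

Lemma left_idealB I x y : submodule I -> I x -> I y -> I (x - y).
Proof.
by move=> sI Ix Iy; rewrite addrC -mulN1r; exact: left_idealMD.
Qed.

Lemma left_ideal_sum I (J : Type) (r : seq J) (F : J -> R) : submodule I ->
  (forall j, I (F j)) -> I (\sum_(j <- r) F j).
Proof.
move=> sI IF; elim/big_ind : _ => //; first exact: left_ideal0.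
by move=> x y; exact: left_idealD.
Qed.

Lemma left_ideal_neq0 I : submodule I ->
  (I <> [set 0]) <-> (exists x, I x /\ x <> 0).
Proof.
move=> sI; split=> [|[x [Ix x0]] I0]; last by move: Ix; rewrite I0.
apply: contra_notP => nI; apply/seteqP; split=> [x Ix|_ ->].
  by apply: contrapT => x0; apply: nI; exists x.
exact: left_ideal0.
Qed.

Lemma submodule_principal x : submodule (range (fun r => r * x) : set R^o).
Proof.
apply: left_ideal_intro; first by exists 0 => //; rewrite mul0r.
  by move=> _ _ [a _ <-] [b _ <-]; exists (a + b) => //; rewrite mulrDl.
by move=> a _ [b _ <-]; exists (a * b) => //; rewrite mulrA.
Qed.

Lemma submodule_setI I N : submodule I -> submodule N -> submodule (I `&` N).
Proof.
move=> sI sN; apply: left_ideal_intro; first by split; exact: left_ideal0.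
  by move=> x y [? ?] [? ?]; split; exact: left_idealD.
by move=> a x [? ?]; split; exact: left_idealM.
Qed.

Lemma submodule_annihilator x : submodule ([set y | y * x = 0] : set R^o).
Proof.
apply: left_ideal_intro => /=; first by rewrite mul0r.
  by move=> y z y0 z0; rewrite mulrDl y0 z0 addr0.
by move=> a y y0; rewrite -mulrA y0 mulr0.
Qed.

Lemma submodule_sum n (N : 'I_n -> set R^o) :
  (forall i, submodule (N i)) -> submodule (sum_submodules N).
Proof.
move=> sN; apply: left_ideal_intro.
- exists (fun=> 0); first by move=> i; exact: left_ideal0.
  by rewrite /= big1.
- move=> _ _ [v Nv <-] [w Nw <-]; exists (fun i => v i + w i).
    by move=> i; exact: left_idealD.
  exact: big_split.
move=> a _ [v Nv <-]; exists (fun i => a * v i).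
  by move=> i; exact: left_idealM.
by rewrite mulr_sumr.
Qed.

(** In a left ideal it suffices to test essentiality on principal left ideals;
    the same reduction serves uniform and simple left ideals. *)
Lemma essential_elementP E : submodule E ->
  essential_submodule E <->
  (forall x, x <> 0 -> exists r, E (r * x) /\ r * x <> 0).
Proof.
move=> sE; split=> [[_ EE] x x0|EE].
  have sx := submodule_principal x.
  have x_neq0 : (range (fun r => r * x) : set R^o) <> [set 0].
    by apply/(left_ideal_neq0 sx); exists x; split=> //; exists 1; rewrite ?mul1r.
  have /(left_ideal_neq0 (submodule_setI sE sx)) := EE _ sx x_neq0.
  by move=> [y [[Ey [r _ yE]] y0]]; exists r; rewrite yE.
split=> // L sL /(left_ideal_neq0 sL)[x [Lx x0]].
apply/(left_ideal_neq0 (submodule_setI sE sL)).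
have [r [Erx rx0]] := EE x x0; exists (r * x); split=> //; split=> //.
exact: left_idealM.
Qed.

Lemma uniform_elementP U : submodule U ->
  uniform_submodule U <->
  (exists x, U x /\ x <> 0) /\
  (forall x y, U x -> U y -> x <> 0 -> y <> 0 ->
     exists r s, r * x = s * y /\ r * x <> 0).
Proof.
move=> sU; split=> [[_ /(left_ideal_neq0 sU) U0 UU]|[U0 UU]].
  split=> // x y Ux Uy x0 y0.
  have [sx sy] := (submodule_principal x, submodule_principal y).
  have xU : (range (fun r => r * x) : set R^o) `<=` U.
    by move=> _ [r _ <-]; exact: left_idealM.
  have yU : (range (fun r => r * y) : set R^o) `<=` U.
    by move=> _ [r _ <-]; exact: left_idealM.
  have := UU _ _ sx sy xU yU.
  have xx : range (fun r => r * x) x by exists 1; rewrite ?mul1r.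
  have yy : range (fun r => r * y) y by exists 1; rewrite ?mul1r.
  move=> /(_ (proj2 (left_ideal_neq0 sx) (ex_intro _ x (conj xx x0)))).
  move=> /(_ (proj2 (left_ideal_neq0 sy) (ex_intro _ y (conj yy y0)))).
  move=> /(left_ideal_neq0 (submodule_setI sx sy))[z [[[r _ rE] [s _ sE]] z0]].
  by exists r, s; rewrite rE sE.
split=> //; first exact/left_ideal_neq0.
move=> L1 L2 sL1 sL2 L1U L2U /(left_ideal_neq0 sL1)[x [Lx x0]].
move=> /(left_ideal_neq0 sL2)[y [Ly y0]].
have [r [s [e rx0]]] := UU _ _ (L1U _ Lx) (L2U _ Ly) x0 y0.
apply/(left_ideal_neq0 (submodule_setI sL1 sL2)); exists (r * x); split=> //.
by split; [|rewrite e]; exact: left_idealM.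
Qed.

Lemma simple_elementP N : submodule N ->
  simple_submodule N <->
  (exists x, N x /\ x <> 0) /\
  (forall x y, N x -> N y -> x <> 0 -> exists r, y = r * x).
Proof.
move=> sN; split=> [[_ /(left_ideal_neq0 sN) N0 NN]|[N0 NN]].
  split=> // x y Nx Ny x0; have sx := submodule_principal x.
  have xN : (range (fun r => r * x) : set R^o) `<=` N.
    by move=> _ [r _ <-]; exact: left_idealM.
  have xx : range (fun r => r * x) x by exists 1; rewrite ?mul1r.
  have [x_eq0|xE] := NN _ sx xN; first by move: xx; rewrite x_eq0.
  by move: Ny; rewrite -xE => -[r _ <-]; exists r.
split=> //; first exact/left_ideal_neq0.
move=> L sL LN; have [|/(left_ideal_neq0 sL)[x [Lx x0]]] := pselect (L = [set 0]).
  by left.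
right; apply/seteqP; split=> // y Ny.
by have [r ->] := NN _ _ (LN _ Lx) Ny x0; exact: left_idealM.
Qed.

Lemma regular1 : regular R 1.
Proof. by split=> x; rewrite ?mulr1 ?mul1r. Qed.

Lemma regularM s t : regular R s -> regular R t -> regular R (s * t).
Proof.
move=> [s1 s2] [t1 t2]; split=> x.
  by rewrite mulrA => /t1/s1.
by rewrite -mulrA => /s2/t2.
Qed.

Lemma regular_mulIr s x y : regular R s -> x * s = y * s -> x = y.
Proof.
move=> [s1 _] e; apply/eqP; rewrite -subr_eq0; apply/eqP/s1.
by rewrite mulrBl e subrr.
Qed.

Lemma regularX s k : regular R s -> regular R (s ^+ k).
Proof.
by move=> ?; elim: k => [|k ?]; [exact: regular1|rewrite exprS; exact: regularM].
Qed.

Lemma regular_left_denominator :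
  left_Ore (regular R) -> left_denominator_set (regular R).
Proof. by move=> ?; split=> // [||s []]; [exact: regular1|exact: regularM|]. Qed.

End LeftIdeals.

(** * Regular elements in essential left ideals *)

Definition essential_meets_regular (R : pzRingType) :=
  forall E : set R^o, essential_submodule E -> exists c, E c /\ regular R c.

(** The hypothesis says that the left ideal of all [r] with [r * x] in [N] is
    essential: if [r * x = 0], then [r] itself belongs to it. *)
Lemma regular_multiple_in (R : pzRingType) (N : set R^o) (x : R) :
  essential_meets_regular R -> submodule N ->
  (forall r, r * x <> 0 -> exists t, N (t * (r * x)) /\ t * (r * x) <> 0) ->
  exists s, regular R s /\ N (s * x).
Proof.
move=> regE sN Nx; pose E : set R^o := [set r | N (r * x)].
have sE : submodule E.
  apply: left_ideal_intro; rewrite /E /=; first by rewrite mul0r; exact: left_ideal0.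
    by move=> r s Er Es; rewrite mulrDl; exact: left_idealD.
  by move=> a r Er; rewrite -mulrA; exact: left_idealM.
have /regE[s []] : essential_submodule E; last by exists s.
apply/(essential_elementP sE) => r r0.
have [rx0|/Nx[t [Nt tr0]]] := pselect (r * x = 0).
  by exists 1; rewrite /E /= mul1r rx0; split=> //; exact: left_ideal0.
by exists t; rewrite /E /= -mulrA; split=> // e; apply: tr0; rewrite mulrA e mul0r.
Qed.

(** * Chains of left ideals with uniform factors *)

Section UniformFlags.
Context {R : pzRingType}.

(** Modulo [S i], any two elements of [S i.+1] outside [S i] have a common
    multiple outside [S i]: the factor [S i.+1 / S i] is uniform. *)
Definition uniform_flag n (S : nat -> set R^o) :=
  [/\ forall i, submodule (S i), S 0%N = [set 0],
      forall i x y, (i < n)%N -> S i.+1 x -> S i.+1 y -> ~ S i x -> ~ S i y ->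
        exists r s, S i (r * x - s * y) /\ ~ S i (r * x) &
      essential_submodule (S n)].

Definition partial_sum n (U : 'I_n -> set R^o) (i : nat) : set R^o :=
  [set x : R | exists v : 'I_n -> R, [/\ forall j, U j (v j),
     forall j : 'I_n, (i <= j)%N -> v j = 0 & x = \sum_j v j]].

Lemma uniform_flag_partial_sum n (U : 'I_n -> set R^o) :
  (forall i, uniform_submodule (U i)) -> direct_sum_submodules U ->
  essential_submodule (sum_submodules U) -> uniform_flag n (partial_sum U).
Proof.
move=> unifU dirU essU; have sU i : submodule (U i) by case: (unifU i).
have combU i a b x y v w : (forall j, U j (v j)) -> (forall j, U j (w j)) ->
    x = \sum_j v j -> y = \sum_j w j ->
    (forall j : 'I_n, (i <= j)%N -> a * v j - b * w j = 0) ->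
    partial_sum U i (a * x - b * y).
  move=> Uv Uw -> -> vw0; exists (fun j => a * v j - b * w j); split=> //.
    move=> j; have sUj := sU j; apply: left_idealB => //; exact: left_idealM.
  by rewrite sumrB !mulr_sumr.
have sS i : submodule (partial_sum U i).
  apply: left_ideal_intro.
  - by exists (fun=> 0); split=> // [j|]; [exact: left_ideal0|rewrite big1].
  - move=> x y [v [Uv v0 xE]] [w [Uw w0 yE]].
    have -> : x + y = 1 * x - (- 1) * y by rewrite mulN1r opprK mul1r.
    by apply: (combU _ _ _ _ _ _ _ Uv Uw xE yE) => j ij;
      rewrite v0 // w0 // !mulr0 subrr.
  - move=> a x [v [Uv v0 xE]].
    have -> : a * x = a * x - 0 * x by rewrite mul0r subr0.
    by apply: (combU _ _ _ _ _ _ _ Uv Uv xE xE) => j ij; rewrite v0 // !mulr0 subrr.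
split=> //.
- apply/seteqP; split=> [_ [v [_ v0 ->]]|_ ->]; last exact: left_ideal0.
  by rewrite /= big1 // => j _; exact: v0.
- move=> i x y ltin [v [Uv v0 xE]] [w [Uw w0 yE]] Six Siy.
  pose i' := Ordinal ltin.
  have split_top (z : 'I_n -> R) : z i' = 0 ->
      (forall j : 'I_n, (i < j)%N -> z j = 0) ->
      forall j : 'I_n, (i <= j)%N -> z j = 0.
    move=> zi zj j; rewrite leq_eqVlt => /orP[/eqP ij|]; last exact: zj.
    by rewrite -zi; congr z; apply: val_inj.
  have vi0 : v i' <> 0.
    by move=> vi; apply: Six; exists v; split=> //; exact: split_top.
  have wi0 : w i' <> 0.
    by move=> wi; apply: Siy; exists w; split=> //; exact: split_top.
  have [_ /(_ _ _ (Uv i') (Uw i') vi0 wi0)[r [s [e rv0]]]] :=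
    proj1 (uniform_elementP (sU i')) (unifU i').
  exists r, s; split.
    apply: (combU _ _ _ _ _ _ _ Uv Uw xE yE); apply: split_top; first by rewrite e subrr.
    by move=> j ij; rewrite v0 // w0 // !mulr0 subrr.
  move=> [z [Uz z0 rxE]]; apply: rv0.
  have rvz : \sum_j (r * v j - z j) = 0.
    by rewrite sumrB -rxE xE mulr_sumr subrr.
  have := dirU _ _ rvz i'; rewrite z0 //= subr0; apply.
  by move=> j; apply: left_idealB => //; exact: left_idealM.
suff -> : partial_sum U n = sum_submodules U by [].
apply/seteqP; split=> [x [v [Uv _ ->]]|_ [v Uv <-]]; first by exists v.
by exists v; split=> // j; rewrite leqNgt ltn_ord.
Qed.

(** The induction along the flag keeps [R c] and the left annihilator of [c]
    disjoint ([x * c * c = 0] implies [x * c = 0]). This is what makes the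
    annihilator of [c + v] the intersection of the annihilators of [c] and [v]
    when [v * c = 0]. *)
Lemma left_regular_in_essential n S (E : set R^o) :
  uniform_flag n S ->
  (forall U : set R^o, uniform_submodule U -> left_regular_in U !=set0) ->
  essential_submodule E -> exists c, E c /\ left_regular R c.
Proof.
move=> [sS S0 unifS essS] regU essE; have [sE _] := essE.
have essE' := proj1 (essential_elementP sE) essE.
suff [c [Ec cc Sc]] : exists c, [/\ E c, forall x, x * c * c = 0 -> x * c = 0 &
    forall x, S n x -> x * c = 0 -> x = 0].
  exists c; split=> // x xc; apply: contrapT => x0.
  have [r [Srx rx0]] := proj1 (essential_elementP (sS n)) essS x x0.
  by apply: rx0; apply: Sc => //; rewrite -mulrA xc mulr0.
have : (n <= n)%N by [].
elim: {1 3}n => [_|i IHi ltin].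
  exists 0; split=> [|x _|x]; first exact: left_ideal0; first by rewrite mulr0.
  by rewrite S0.
have [c [Ec cc Sc]] := IHi (ltnW ltin).
pose A : set R^o := S i.+1 `&` [set x | x * c = 0].
have sA : submodule A by apply: submodule_setI => //; exact: submodule_annihilator.
have [Sc'|/existsNP[x0 /not_implyP[Sx0 /not_implyP[x0c x0_neq0]]]] :=
  pselect (forall x, S i.+1 x -> x * c = 0 -> x = 0); first by exists c.
(* As the annihilator of [c] misses [S i], [V] embeds in [S i.+1 / S i]. *)
pose V := E `&` A; have sV : submodule V by exact: submodule_setI.
have dropS x : V x -> x <> 0 -> ~ S i x.
  by move=> [_ [_ xc]] x_neq0 Sx; apply: x_neq0; exact: Sc.
have unifV : uniform_submodule V.
  apply/(uniform_elementP sV); split.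
    have [r [Er r0]] := essE' _ x0_neq0; exists (r * x0); split=> //.
    by split=> //; apply: left_idealM.
  move=> x y Vx Vy x_neq0 y_neq0.
  have [[_ [Sx xc]] [_ [Sy yc]]] := (Vx, Vy).
  have [r [s [Srs Sr]]] := unifS i _ _ ltin Sx Sy
    (dropS _ Vx x_neq0) (dropS _ Vy y_neq0).
  exists r, s; split; last by move=> rx0; apply: Sr; rewrite rx0; exact: left_ideal0.
  apply/eqP; rewrite -subr_eq0; apply/eqP/Sc => //.
  by rewrite mulrBl -!mulrA xc yc !mulr0 subrr.
have [v [Vv vinj]] := regU V unifV; have [Ev [Sv vc]] := Vv.
have vreg x : V x -> x * v = 0 -> x = 0.
  move=> Vx xv; apply: vinj; rewrite ?inE //; first exact: left_ideal0.
  by rewrite /= xv mul0r.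
have ann x : x * (c + v) = 0 -> x * c = 0 /\ x * v = 0.
  rewrite mulrDr => e; suff xc : x * c = 0 by move: e; rewrite xc add0r.
  apply: cc; have -> : x * c = - (x * v) by apply/eqP; rewrite -addr_eq0 e.
  by rewrite mulNr -mulrA vc mulr0 oppr0.
exists (c + v); split; first exact: left_idealD.
  move=> x /ann[]; rewrite !mulrDr !mulrDl -!mulrA vc !mulr0 addr0 !mulrA => xcc.
  have xc := cc _ xcc; rewrite xc mul0r !add0r => xvv.
  by apply: vreg => //; exact: left_idealM.
move=> x Sx /ann[xc xv]; apply: contrapT => x_neq0.
have [r [Er r0]] := essE' _ x_neq0; apply: r0; apply: vreg.
  by split=> //; split; [exact: left_idealM|rewrite /= -mulrA xc mulr0].
by rewrite -mulrA xv mulr0.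
Qed.

(** By induction on [i], the claim holds for the elements of the chain in
    [S i]. Either the chain falls into [S i] inside [S i.+1] from some point
    on, or every [A k] has an element [a] in [S i.+1] outside [S i]; in the
    latter case any [x] in [S i.+1] has a regular multiple in [S i] modulo
    [R a], which reduces the claim to level [i] without moving [m]. *)
Lemma descending_chain_torsion n S (A : nat -> set R^o) :
  essential_meets_regular R -> uniform_flag n S ->
  (forall k, submodule (A k)) -> (forall k, A k.+1 `<=` A k) ->
  exists m, forall k x, (m <= k)%N -> A m x ->
    exists w, regular R w /\ A k (w * x).
Proof.
move=> regE [sS S0 unifS essS] sA decA.
have leA k l : (k <= l)%N -> A l `<=` A k.
  move=> /subnKC <-; elim: (l - k)%N => [|d IHd]; first by rewrite addn0.
  by rewrite addnS => x /decA/IHd.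
suff [m mP] : exists m, forall k x, (m <= k)%N -> A m x -> S n x ->
    exists w, regular R w /\ A k (w * x).
  exists m => k x lemk Ax.
  have [|s [regs Ssx]] := regular_multiple_in (x := x) regE (sS n).
    by move=> r rx0; exact: (proj1 (essential_elementP (sS n)) essS).
  have [w [regw Awx]] := mP k _ lemk (left_idealM s (sA m) Ax) Ssx.
  by exists (w * s); split; [exact: regularM|rewrite -mulrA].
have : (n <= n)%N by [].
elim: {1 3}n => [_|i IHi ltin].
  exists 0%N => k x _ _; rewrite S0 => ->; exists 1.
  by split; [exact: regular1|rewrite mulr0; exact: left_ideal0].
have [m mP] := IHi (ltnW ltin).
have [[l lP]|noP] := pselect (exists l, A l `&` S i.+1 `<=` S i).
  exists (maxn l m) => k x; rewrite geq_max => /andP[lk mk] Ax Sx.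
  apply: mP => //; first by apply: (leA _ (maxn l m)) => //; exact: leq_maxr.
  by apply: lP; split=> //; apply: (leA _ (maxn l m)) => //; exact: leq_maxl.
exists m => k x mk Ax Sx.
have [a [[Aa Sa] Sa']] : exists a, (A k `&` S i.+1) a /\ ~ S i a.
  apply: contra_notP noP => noP; exists k => a Aa.
  by apply: contrapT => Sa; apply: noP; exists a.
pose N : set R^o := [set z | exists t, S i (z - t * a)].
have SN : S i `<=` N by move=> z Sz; exists 0; rewrite mul0r subr0.
have sN : submodule N.
  apply: left_ideal_intro; first by apply: SN; exact: (left_ideal0 (sS i)).
    move=> y z [t Sy] [u Sz]; exists (t + u).
    by rewrite mulrDl opprD addrACA; exact: (left_idealD (sS i)).
  by move=> b y [t Sy]; exists (b * t); rewrite -mulrA -mulrBr;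
    exact: (left_idealM _ (sS i)).
have [|s [regs [t Sst]]] := regular_multiple_in (x := x) regE sN.
  move=> r rx0; have [Srx|Srx] := pselect (S i (r * x)).
    by exists 1; rewrite mul1r; split=> //; exact: SN.
  have Srx' : S i.+1 (r * x) by exact: (left_idealM _ (sS i.+1)).
  have [t [u [Stu St]]] := unifS _ _ _ ltin Srx' Sa Srx Sa'.
  exists t; split; first by exists u.
  by move=> e; apply: St; rewrite e; exact: (left_ideal0 (sS i)).
have [|w [regw Aw]] := mP k _ mk _ Sst.
  apply: (left_idealB (sA m)); apply: (left_idealM _ (sA m)) => //.
  exact: (leA _ k).
exists (w * s); split; first exact: regularM.
have -> : w * s * x = w * (s * x - t * a) + w * t * a.
  by rewrite mulrBr !mulrA subrK.
by apply: (left_idealD (sA k)) => //; exact: left_idealM.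
Qed.

(** The chain [R c^k] stabilizes up to torsion, so a regular multiple of
    [r c^m] is of the form [t c^(m+1)], and [c^m] cancels on the right. *)
Lemma left_Ore_of_flag n S :
  essential_meets_regular R -> uniform_flag n S -> left_Ore (regular R).
Proof.
move=> regE flagS r c regc.
pose A k : set R^o := range (fun x => x * c ^+ k).
have [||m mP] := descending_chain_torsion (A := A) regE flagS.
- by move=> k; exact: submodule_principal.
- by move=> k _ [x _ <-]; exists (x * c) => //; rewrite exprS mulrA.
have [|s [regs [t _ e]]] := mP m.+1 (r * c ^+ m) (leqnSn m); first by exists r.
exists s, t; split=> //; apply: (regular_mulIr (regularX m regc)).
by rewrite -!mulrA -exprS -e.
Qed.

End UniformFlags.

(** * Left ideals of a left quotient ring *)

Section QuotientRing.
Context {R Q : pzRingType} {f : {rmorphism R -> Q}}.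
Hypothesis OreR : left_Ore (regular R).
Hypothesis fQ : left_quotient_ring (regular R) f.

(** This is the left ideal [Q I] of [Q]. *)
Definition extension (I : set R^o) : set Q^o :=
  [set q : Q | exists s r, [/\ regular R s, I r & f s * q = f r]].

Lemma quotient_fraction q : exists s r, regular R s /\ f s * q = f r.
Proof. by case: fQ. Qed.

Lemma quotient_inj0 r : f r = 0 -> r = 0.
Proof. by case: fQ => _ _ fr0 /fr0[s [[_ sreg] /sreg]]. Qed.

Lemma quotient_inj : injective f.
Proof.
move=> x y e; apply/eqP; rewrite -subr_eq0; apply/eqP/quotient_inj0.
by rewrite rmorphB e subrr.
Qed.

Lemma quotient_mulI0 s q : regular R s -> f s * q = 0 -> q = 0.
Proof.
case: fQ => fU _ _ /fU[u [us _]] sq.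
by rewrite -[q]mul1r -us -mulrA sq mulr0.
Qed.

Lemma quotient_common_denominator (qs : seq Q) :
  exists s, regular R s /\ forall q, q \in qs -> exists r, f s * q = f r.
Proof.
elim: qs => [|q qs [s [regs sP]]]; first by exists 1; split=> //; exact: regular1.
have [t [r [regt tq]]] := quotient_fraction q.
have [a [b [rega e]]] := OreR s regt.
exists (a * s); split; first exact: regularM.
move=> p; rewrite inE => /predU1P[->|/sP[u su]].
  by exists (b * r); rewrite e !rmorphM -mulrA tq.
by exists (a * u); rewrite !rmorphM -mulrA su.
Qed.

Lemma submodule_extension (I : set R^o) : submodule I -> submodule (extension I).
Proof.
move=> sI; apply: left_ideal_intro.
- exists 1, 0; rewrite !(rmorph0, mulr0).
  by split=> //; [exact: regular1|exact: left_ideal0].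
- move=> p q [s [r [regs Ir sp]]] [t [u [regt Iu tq]]].
  have [a [b [rega e]]] := OreR s regt.
  exists (a * s), (a * r + b * u); split; first exact: regularM.
    by apply: left_idealD => //; exact: left_idealM.
  by rewrite mulrDr {2}e !rmorphM -!mulrA sp tq -!rmorphM -rmorphD.
- move=> p q [s [r [regs Ir sq]]].
  have [t [u [regt tp]]] := quotient_fraction p.
  have [a [b [rega e]]] := OreR u regs.
  exists (a * t), (b * r); split; [exact: regularM|exact: left_idealM|].
  by rewrite rmorphM mulrA -(mulrA (f a)) tp -rmorphM e rmorphM -mulrA sq rmorphM.
Qed.

Lemma sub_extension (I : set R^o) r : I r -> extension I (f r).
Proof.
by move=> Ir; exists 1, r; split=> //; [exact: regular1|rewrite rmorph1 mul1r].
Qed.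

Lemma submodule_contraction (N : set Q^o) :
  submodule N -> submodule (f @^-1` N : set R^o).
Proof.
move=> sN; apply: left_ideal_intro => [|x y Nx Ny|a x Nx].
- by rewrite /preimage /= rmorph0; exact: left_ideal0.
- by rewrite /preimage /= rmorphD; exact: left_idealD.
- by rewrite /preimage /= rmorphM; exact: left_idealM.
Qed.

Lemma contraction_fraction (N : set Q^o) q : submodule N -> N q ->
  exists s r, [/\ regular R s, N (f r) & f s * q = f r].
Proof.
move=> sN Nq; have [s [r [regs e]]] := quotient_fraction q.
by exists s, r; split=> //; rewrite -e; exact: left_idealM.
Qed.

(** Two nonzero elements [s^-1 v] and [t^-1 w] of [Q U] are multiples of each
    other: a regular multiple of [w] lies in [R v] because [U] is uniform. *)
Lemma simple_extension (U : set R^o) : essential_meets_regular R ->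
  uniform_submodule U -> simple_submodule (extension U).
Proof.
move=> regE unifU; have sU : submodule U by case: unifU.
have [[u [Uu u0]] UU] := proj1 (uniform_elementP sU) unifU.
apply/(simple_elementP (submodule_extension sU)); split.
  exists (f u); split; first exact: sub_extension.
  by move=> /quotient_inj0.
move=> x y [s [v [regs Uv sx]]] [t [w [regt Uw ty]]] x0.
have v0 : v <> 0.
  by move=> v0; apply: x0; apply: (quotient_mulI0 regs); rewrite sx v0 rmorph0.
have [|a [rega [b _ bv]]] :=
    regular_multiple_in (x := w) regE (submodule_principal v).
  move=> r rw0; have [c [d [e crw0]]] := UU _ _ (left_idealM r sU Uw) Uv rw0 v0.
  by exists c; split=> //; exists d.
case: fQ => fU _ _; have [i [ia _]] := fU _ (regularM rega regt).
exists (i * f b * f s).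
have abty : f b * (f s * x) = f (a * t) * y :> Q.
  by rewrite sx -rmorphM bv !rmorphM -ty mulrA.
by rewrite -!mulrA abty mulrA ia mul1r.
Qed.

Lemma uniform_contraction (N : set Q^o) :
  simple_submodule N -> uniform_submodule (f @^-1` N : set R^o).
Proof.
move=> simN; have sN : submodule N by case: simN.
have [[q [Nq q0]] NN] := proj1 (simple_elementP sN) simN.
apply/(uniform_elementP (submodule_contraction sN)); split.
  have [s [r [regs Nr e]]] := contraction_fraction sN Nq.
  exists r; split=> // r0; apply: q0; apply: (quotient_mulI0 regs).
  by rewrite e r0 rmorph0.
move=> x y Nx Ny x0 y0.
have [|p yE] := NN _ _ Nx Ny; first by move=> /quotient_inj0.
have [s [r [regs sp]]] := quotient_fraction p.
have e : r * x = s * y.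
  by apply: quotient_inj; rewrite !rmorphM -sp yE mulrA.
by exists r, s; split=> //; rewrite e; case: regs => _ /[apply].
Qed.

(** A regular element [c] of the sum of the [U i] is invertible in [Q], so
    every [x] equals [x * c^-1 * c] and lies in the sum of the [Q U_i]. For
    the chain condition, left ideals of [Q] are recovered from their
    contractions, and torsion is invisible in [Q]. *)
Lemma semisimple_artinian_quotient n (U : 'I_n -> set R^o) :
  essential_meets_regular R -> (forall i, uniform_submodule (U i)) ->
  direct_sum_submodules U -> essential_submodule (sum_submodules U) ->
  semisimple_artinian_ring Q.
Proof.
move=> regE unifU dirU essU; split.
  move=> x; have [c [[u Uu uc] regc]] := regE _ essU.
  exists n, (fun i => extension (U i)); split.
    by move=> i; exact: simple_extension.
  case: fQ => fU _ _; have [i [ic _]] := fU _ regc.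
  exists (fun j => x * i * f (u j)).
    move=> j; apply: left_idealM; last exact: sub_extension.
    by apply: submodule_extension; case: (unifU j).
  by rewrite -mulr_sumr -rmorph_sum uc -mulrA ic mulr1.
move=> N sN decN.
have flagU := uniform_flag_partial_sum unifU dirU essU.
have [||m mP] := descending_chain_torsion
    (A := fun k => f @^-1` N k : set R^o) regE flagU.
- by move=> k; exact: submodule_contraction.
- by move=> k x; exact: decN.
have leN k : (m <= k)%N -> N k `<=` N m.
  move=> /subnKC <-; elim: (k - m)%N => [|d IHd]; first by rewrite addn0.
  by rewrite addnS => x /decN/IHd.
exists m => k mk; apply/seteqP; split; first exact: leN.
move=> q Nq; have [s [r [regs Nr sq]]] := contraction_fraction (sN m) Nq.
have [w [regw]] := mP k r mk Nr; rewrite /preimage /= rmorphM -sq => Nkq.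
case: fQ => fU _ _; have [i [iws _]] := fU _ (regularM regw regs).
have -> : q = i * (f w * (f s * q)).
  by rewrite (mulrA (f w)) -rmorphM mulrA iws mul1r.
exact: left_idealM.
Qed.

(** Every simple left ideal of [Q] has a nonzero element in [R], hence one in
    [E], and is therefore contained in [Q E]; so [1] is in [Q E]. *)
Lemma regular_in_essential_of_semisimple :
  semisimple_module Q^o -> essential_meets_regular R.
Proof.
move=> ssQ E essE; have [sE _] := essE.
have essE' := proj1 (essential_elementP sE) essE.
have [n [N [simN [v Nv v1]]]] := ssQ 1.
have : extension E 1.
  rewrite -v1; apply: (left_ideal_sum _ (submodule_extension sE)) => i.
  have sN : submodule (N i) by case: (simN i).
  have [vi0|vi0] := pselect (v i = 0).
    by rewrite vi0; exact: left_ideal0 (submodule_extension sE).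
  have [s [r [regs Nr sv]]] := contraction_fraction sN (Nv i).
  have [|t [Et t0]] := essE' r.
    by move=> r0; apply: vi0; apply: (quotient_mulI0 regs); rewrite sv r0 rmorph0.
  have [_ /(_ (f (t * r)) (v i))[|//||q ->]] := proj1 (simple_elementP sN) (simN i).
  - by rewrite rmorphM; exact: left_idealM.
  - by move=> /quotient_inj0.
  - exact: left_idealM (submodule_extension sE) (sub_extension Et).
by move=> [s [r [regs Er]]]; rewrite mulr1 => /quotient_inj e; exists s;
  split=> //; rewrite e.
Qed.

(** The chain [Q r^k] stops, which gives [p * r^(m+1) = r^m] in [Q]; as [r]
    stays left regular in [Q], [r^m] cancels and [p] is a left inverse of
    [r]. *)
Lemma left_regular_of_artinian :
  artinian_module Q^o -> left_regular R = regular R.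
Proof.
move=> artQ; apply/seteqP; split=> [r rreg|r []//]; split=> // x rx.
have frreg p : p * f r = 0 -> p = 0.
  have [s [a [regs e]]] := quotient_fraction p => pr.
  apply: (quotient_mulI0 regs); rewrite e; suff -> : a = 0 by rewrite rmorph0.
  by apply/rreg/quotient_inj0; rewrite rmorphM -e -mulrA pr mulr0.
have frregX k p : p * f r ^+ k = 0 -> p = 0.
  elim: k p => [|k IHk] p; first by rewrite mulr1.
  by rewrite exprS mulrA => /IHk/frreg.
have [||m /(_ m.+1 (leqnSn m)) mP] := artQ (fun k => range (fun p => p * f r ^+ k)).
- by move=> k; exact: submodule_principal.
- by move=> k _ [p _ <-]; exists (p * f r) => //; rewrite exprS mulrA.
have : range (fun p => p * f r ^+ m) (f r ^+ m) by exists 1; rewrite ?mul1r.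
rewrite -mP => -[p _]; rewrite exprS mulrA => e.
have pr : p * f r = 1.
  apply/eqP; rewrite -subr_eq0; apply/eqP/(frregX m).
  by rewrite mulrBl e mul1r subrr.
by apply: quotient_inj0; rewrite -[f x]mul1r -pr -mulrA -rmorphM rx rmorph0 mulr0.
Qed.

End QuotientRing.

(** * The remaining conditions on the base ring *)

(** A family of simple left ideals that is not independent has a redundant
    member: a relation with a nonzero term in [N j] puts the simple left
    ideal [N j] inside the sum of the others. *)
Lemma semisimple_direct_decomposition (Q : pzRingType) n (N : 'I_n -> set Q^o) :
  (forall i, simple_submodule (N i)) -> sum_submodules N 1 ->
  exists m (N' : 'I_m -> set Q^o), [/\ forall i, simple_submodule (N' i),
    direct_sum_submodules N' & sum_submodules N' 1].
Proof.
elim: n N => [|n IHn] N simN N1; first by exists 0%N, N; split=> // v _ _ [].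
have sN i : submodule (N i) by case: (simN i).
have [dirN|] := pselect (direct_sum_submodules N); first by exists n.+1, N.
move=> /existsNP[v /not_implyP[Nv /not_implyP[v0 /existsNP[j vj0]]]].
have [w Nw w1] := N1.
have [_ /(_ _ _ (Nv j) (Nw j) vj0)[r wj]] := proj1 (simple_elementP (sN j)) (simN j).
apply: (IHn (N \o lift j)); first by move=> i; exact: simN.
exists (fun i => w (lift j i) - r * v (lift j i)).
  by move=> i; apply: (left_idealB (sN _)) => //; exact: (left_idealM _ (sN _)).
have <- : \sum_i (w i - r * v i) = 1 by rewrite sumrB w1 -mulr_sumr v0 mulr0 subr0.
by rewrite (bigD1_ord j) //= wj subrr add0r.
Qed.

(** Clearing denominators in the components of [f x] gives a multiple of [x]
    in the sum of the contractions, hence that sum is essential. *)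
Lemma finite_udim_of_semisimple (R Q : pzRingType) (f : {rmorphism R -> Q}) :
  left_Ore (regular R) -> left_quotient_ring (regular R) f ->
  semisimple_module Q^o -> finite_udim R^o.
Proof.
move=> OreR fQ ssQ; have [n0 [N0 [simN0 N01]]] := ssQ 1.
have [n [N [simN dirN [v Nv v1]]]] := semisimple_direct_decomposition simN0 N01.
have sN i : submodule (N i) by case: (simN i).
pose U i : set R^o := f @^-1` N i.
have sU i : submodule (U i) by exact: submodule_contraction.
have sSU : submodule (sum_submodules U) by exact: submodule_sum.
exists n, U; split.
- by move=> i; exact: (uniform_contraction fQ).
- move=> u Uu u0 i; apply: (quotient_inj0 fQ); apply: (dirN (fun i => f (u i))) => //.
  by rewrite -rmorph_sum u0 rmorph0.
apply/(essential_elementP sSU) => x x0.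
have [s [regs sP]] :=
  quotient_common_denominator OreR fQ [seq f x * v i | i <- enum 'I_n].
have /choice[u uE] i : exists r, f s * (f x * v i) = f r.
  by apply: sP; apply/mapP; exists i; rewrite ?mem_enum.
exists s; split; last by case: regs => _ /[apply].
exists u; first by move=> i; rewrite /U /preimage /= -uE; do 2!apply: left_idealM => //.
apply: (quotient_inj fQ); rewrite rmorph_sum rmorphM -[f x in RHS]mulr1 -v1.
by rewrite !mulr_sumr; apply: eq_bigr => i _; rewrite uE.
Qed.

(** For [x] nonzero, a longest product of elements of [I] not killing [x] from
    the left yields a nonzero multiple of [x] in the right annihilator [E] of
    [I]; so [E] is essential and contains a regular [c], and [I c = 0]. *)
Lemma semiprime_of_essential_regular (R : pzRingType) :
  essential_meets_regular R -> semiprime_ring R.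
Proof.
move=> regE I [sI IR] [n In].
pose E : set R^o := [set x | forall y, I y -> y * x = 0].
have sE : submodule E.
  apply: left_ideal_intro; rewrite /E /=.
  - by move=> y _; rewrite mulr0.
  - by move=> x y Ex Ey z Iz; rewrite mulrDr Ex // Ey // addr0.
  - by move=> a x Ex y Iy; rewrite mulrA; apply: Ex; exact: IR.
have essE : essential_submodule E.
  apply/(essential_elementP sE) => x x0.
  have killx : exists k, forall v : 'I_k -> R,
      (forall i, I (v i)) -> (\prod_i v i) * x = 0.
    by exists n => v Iv; rewrite In // mul0r.
  have {}killx : exists k, `[< forall v : 'I_k -> R,
      (forall i, I (v i)) -> (\prod_i v i) * x = 0 >].
    by have [k kP] := killx; exists k; exact/asboolP.
  have [[|k] /asboolP kP kmin] := ex_minnP killx.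
    by case: x0; have := kP (fun=> 0); rewrite big_ord0 mul1r; apply; case.
  have [v /not_implyP[Iv vx]] : exists v : 'I_k -> R,
      ~ ((forall i, I (v i)) -> (\prod_i v i) * x = 0).
    by apply/existsNP => vP; have := kmin k (asboolT vP); rewrite ltnn.
  exists (\prod_i v i); split=> // y Iy.
  have := kP (fun i => oapp v y (unlift ord0 i)).
  rewrite big_ord_recl unlift_none /= mulrA => <-.
    congr (_ * _ * _); apply: eq_bigr => i _.
    by rewrite liftK.
  by move=> i; case: (unliftP ord0 i) => [j _|_]; [exact: Iv|exact: Iy].
have [c [Ec [creg _]]] := regE E essE.
apply/seteqP; split=> [x Ix|_ ->]; last exact: left_ideal0.
by apply: creg; exact: Ec.
Qed.

(** If no [u] in [U] acts injectively, the kernels in the uniform [U] are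
    essential in [U], which forces [U^2 = 0]. In a semiprime ring this is
    impossible: writing [J] for the left annihilator of [U], the elements
    of [J] killed by [J] from the left form a square-zero ideal
    containing [U]. *)
Lemma left_regular_in_uniform (R : pzRingType) (U : set R^o) :
  essential_meets_regular R -> semiprime_ring R -> uniform_submodule U ->
  left_regular_in U !=set0.
Proof.
move=> regE spR unifU; have sU : submodule U by case: unifU.
have [[x0 [Ux0 x0_neq0]] UU] := proj1 (uniform_elementP sU) unifU.
apply: contrapT => noreg.
have UU0 u x : U u -> U x -> x * u = 0.
  move=> Uu Ux.
  have [k [Uk [ku k0]]] : exists k, U k /\ k * u = 0 /\ k <> 0.
    apply: contra_notP noreg => nok; exists u; split=> // y z.
    rewrite !inE => Uy Uz e; apply/eqP; rewrite -subr_eq0; apply/eqP.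
    apply: contrapT => yz0; apply: nok; exists (y - z).
    by split; [exact: left_idealB|split; rewrite ?mulrBl ?e ?subrr].
  have [|c [[_ creg]]] :=
      regular_multiple_in (x := x) regE (submodule_annihilator u).
    move=> r rx0; have [a [b [e ax0]]] := UU _ _ (left_idealM r sU Ux) Uk rx0 k0.
    by exists a; split=> //=; rewrite e -mulrA ku mulr0.
  by rewrite /= -mulrA => /creg.
pose I : set R^o := [set x | (forall u, U u -> x * u = 0) /\
  (forall y, (forall u, U u -> y * u = 0) -> y * x = 0)].
have UI : U `<=` I by move=> x Ux; split=> [u Uu|y /(_ x Ux)//]; exact: UU0.
have sI : submodule I.
  apply: left_ideal_intro.
  - by split=> [u|y] _; rewrite ?mul0r ?mulr0.
  - move=> x y [Ux xU] [Uy yU]; split=> [u Uu|z zU].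
      by rewrite mulrDl Ux // Uy // addr0.
    by rewrite mulrDr xU // yU // addr0.
  - move=> a x [Ux xU]; split=> [u Uu|z zU]; first by rewrite -mulrA Ux // mulr0.
    rewrite mulrA; apply: xU => u Uu; rewrite -mulrA; apply: zU.
    exact: left_idealM.
have : I = [set 0].
  apply: spR.
    split=> // x r [Ux xU]; split=> [u Uu|y yU].
      by rewrite -mulrA; apply: Ux; exact: left_idealM.
    by rewrite mulrA xU // mul0r.
  exists 2 => v Iv; rewrite !big_ord_recl big_ord0 mulr1.
  by have [_ ->] := Iv (lift ord0 ord0) => //; have [] := Iv ord0.
by move=> I0; apply: x0_neq0; have := UI _ Ux0; rewrite I0.
Qed.

Theorem theorem1p3 (R : pzRingType) :
  Qlcl_semisimple_artinian R <->
  [/\ semiprime_ring R, finite_udim R^o, left_regular R = regular R &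
      forall U : set R^o, uniform_submodule U ->
        (left_regular_in U !=set0)%classic].
Proof.
split=> [[OreR [Q [f [fQ [ssQ artQ]]]]]|[_ [n [U [unifU dirU essU]]] lregE regU]].
  have regE := regular_in_essential_of_semisimple OreR fQ ssQ.
  have spR := semiprime_of_essential_regular regE.
  split=> //; first exact: finite_udim_of_semisimple OreR fQ ssQ.
    exact: left_regular_of_artinian fQ artQ.
  by move=> U; exact: left_regular_in_uniform.
have flagU := uniform_flag_partial_sum unifU dirU essU.
have regE : essential_meets_regular R.
  by move=> E; rewrite -lregE; exact: left_regular_in_essential flagU regU.
have OreR := left_Ore_of_flag regE flagU; split=> //.
have [Q [f fQ]] :=
  fractions_left_quotient_ring (regular_left_denominator OreR).
exists Q, f; split=> //.
exact: (semisimple_artinian_quotient OreR fQ regE unifU dirU essU).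
Qed.
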